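(* Let $K$ be a field of characteristic zero and $P_m=K[x_1,\ldots,x_m]$ a polynomial algebra. For any $\sigma\in\mathrm{Aut}_K(P_m)$, $$\sigma=\sum_{\alpha\in\mathbb N^m}\frac{(\sigma(x)-x)^\alpha}{\alpha!}\partial^\alpha=\mathrm{id}_{P_m}+\sum_{i=1}^m(\sigma(x_i)-x_i)\partial_i+\cdots,$$ where $\frac{(\sigma(x)-x)^\alpha}{\alpha!}:=\prod_{i=1}^m\frac{(\sigma(x_i)-x_i)^{\alpha_i}}{\alpha_i!}$.
   Context: $\partial_i=\frac{\partial}{\partial x_i}$ are the partial derivatives of $P_m$ and $\partial^\alpha=\partial_1^{\alpha_1}\cdots\partial_m^{\alpha_m}$. $\mathrm{Aut}_K(P_m)$ is the group of $K$-algebra automorphisms. The equality is one of $K$-linear maps $P_m\to P_m$: for each $p\in P_m$ the sum $\sum_\alpha\frac{(\sigma(x)-x)^\alpha}{\alpha!}\partial^\alpha(p)$ is finite. *)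

(* Defs.v *)
From HB Require Import structures.
From mathcomp Require Import all_boot all_order all_algebra.
From mathcomp Require Import mpoly.

Set Implicit Arguments.
Unset Strict Implicit.
Unset Printing Implicit Defensive.

Import GRing.Theory.
Local Open Scope ring_scope.

(* The sum over an infinite index type, for finitely supported families only:
   r is any duplicate-free list covering the support. *)
Definition has_finsum (I : eqType) (V : nmodType) (P : pred I) (F : I -> V)
    (s : V) : Prop :=
  exists r : seq I,
    [/\ uniq r, (forall i, P i -> F i != 0 -> i \in r)
      & s = \sum_(i <- r | P i) F i].

Lemma has_finsum_unique (I : eqType) (V : nmodType) (P : pred I) (F : I -> V)
    (s t : V) : has_finsum P F s -> has_finsum P F t -> s = t.
Proof.
move=> [r1 [u1 h1 ->]] [r2 [u2 h2 ->]].
have nz (r : seq I) :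
    \sum_(i <- r | P i) F i
    = \sum_(i <- [seq i <- r | P i && (F i != 0)]) F i.
  rewrite big_filter (bigID (fun i => F i != 0)) /= [X in _ + X]big1 ?addr0 //.
  by move=> i /andP[_ /negbNE/eqP].
rewrite (nz r1) (nz r2); apply/perm_big/uniq_perm; rewrite ?filter_uniq //.
move=> i; rewrite !mem_filter; case: (boolP (P i)) => //= Pi.
by case: (boolP (F i != 0)) => //= Fi; rewrite h1 ?h2.
Qed.

Definition taylor_coef (K : fieldType) (m : nat)
    (sigma : {mpoly K[m]} -> {mpoly K[m]}) (alpha : 'X_{1..m}) : {mpoly K[m]} :=
  \prod_(i < m) (((alpha i)`!)%:R^-1 *: (sigma 'X_i - 'X_i) ^+ alpha i).

Definition taylor_term (K : fieldType) (m : nat)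
    (sigma : {mpoly K[m]} -> {mpoly K[m]}) (alpha : 'X_{1..m})
    (p : {mpoly K[m]}) : {mpoly K[m]} :=
  taylor_coef sigma alpha * mderivm alpha p.

(* Main.v *)
(** Taylor's formula is linear in [p], so it suffices to expand a monomial:
    writing [sigma x_i = x_i + h_i], the multiplicativity of [sigma] and the
    binomial theorem in each variable turn [sigma (x^mu)] into the sum of the
    [\prod_i 'C(mu_i, alpha_i) h_i^alpha_i x_i^(mu_i - alpha_i)], which is
    [h^alpha / alpha! * d^alpha (x^mu)] because [mu^_alpha / alpha!] is the
    binomial coefficient. *)
Require Import Defs.
From HB Require Import structures.
From mathcomp Require Import all_boot all_order all_algebra.
From mathcomp Require Import mpoly.

Set Implicit Arguments.
Unset Strict Implicit.
Unset Printing Implicit Defensive.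

Import GRing.Theory.
Local Open Scope ring_scope.

(** The added terms vanish because ['C(n, i) = 0] for [i > n]. A range independent of [n] lets the
    expansions in all variables share one index type, as distributing a product over sums
    requires. *)
Lemma exprDn_widen (R : pzSemiRingType) (x y : R) (n N : nat) :
  GRing.comm x y -> (n <= N)%N ->
  (x + y) ^+ n = \sum_(i < N.+1) (x ^+ (n - i) * y ^+ i) *+ 'C(n, i).
Proof.
move=> cxy le_nN; rewrite exprDn_comm //.
rewrite (big_ord_widen N.+1 (fun i => (x ^+ (n - i) * y ^+ i) *+ 'C(n, i))) //.
rewrite big_mkcond /=; apply: eq_bigr => i _.
by case: ltnP => // lt_ni; rewrite bin_small.
Qed.

(** The coefficient of [mu] in the derivative is a multiple of that of [mu + alpha] in [p], which is
    zero once [mdeg alpha] reaches [msize p]. *)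
Lemma mderivm_neq0 (R : nzRingType) (n : nat) (alpha : 'X_{1..n})
    (p : {mpoly R[n]}) :
  mderivm alpha p != 0 -> (mdeg alpha < msize p)%N.
Proof.
apply: contra_neqT; rewrite -leqNgt => le_pa; apply/mpolyP => mu.
rewrite mcoeff_mderivm mcoeff0 memN_msupp_eq0 ?mul0rn //.
by apply: msize_mdeg_ge; rewrite mdegD (leq_trans le_pa) ?leq_addr.
Qed.

Lemma leq_mnm_mdeg (n : nat) (alpha : 'X_{1..n}) (i : 'I_n) :
  (alpha i <= mdeg alpha)%N.
Proof. by rewrite mdegE (bigD1 i) //= leq_addr. Qed.

Section Taylor.

Variables (K : fieldType) (m : nat).
Implicit Types (alpha mu : 'X_{1..m}) (p : {mpoly K[m]}).

(** A box rather than a degree bound: indexing by finite functions matches the sum obtained by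
    expanding a product of sums. *)
Definition mnm_box (N : nat) : seq 'X_{1..m} :=
  [seq [multinom (f i : nat) | i < m] | f : {ffun 'I_m -> 'I_N.+1}].

Lemma mnm_box_uniq (N : nat) : uniq (mnm_box N).
Proof.
rewrite map_inj_uniq ?enum_uniq // => f g /mnmP eq_fg.
by apply/ffunP => i; apply: val_inj; have := eq_fg i; rewrite !mnmE.
Qed.

Lemma mem_mnm_box (N : nat) alpha :
  (forall i, alpha i <= N)%N -> alpha \in mnm_box N.
Proof.
move=> le_aN; apply/mapP; exists [ffun i => inord (alpha i)].
  by rewrite mem_enum.
by apply/mnmP => i; rewrite mnmE ffunE inordK // ltnS.
Qed.

Section Endomorphism.

Variable sigma : {lrmorphism {mpoly K[m]} -> {mpoly K[m]}}.

Lemma taylor_term_sumZ (I : Type) (r : seq I) (c : I -> K)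
    (F : I -> {mpoly K[m]}) alpha :
  taylor_term sigma alpha (\sum_(i <- r) c i *: F i) =
  \sum_(i <- r) c i *: taylor_term sigma alpha (F i).
Proof.
rewrite /taylor_term linear_sum mulr_sumr; apply: eq_bigr => i _.
by rewrite linearZ scalerAr.
Qed.

Lemma taylor_term0 p : taylor_term sigma 0%MM p = p.
Proof.
rewrite /taylor_term mderivm0m /taylor_coef big1 ?mul1r // => i _.
by rewrite mnm0E expr0 fact0 invr1 scale1r.
Qed.

Lemma taylor_termU (i : 'I_m) p :
  taylor_term sigma U_(i)%MM p = (sigma 'X_i - 'X_i) * mderiv i p.
Proof.
rewrite /taylor_term mderivmU1m /taylor_coef (bigD1 i) //= big1 ?mulr1.
  by rewrite mnm1E eqxx expr1 invr1 scale1r.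
move=> j neq_ji; rewrite mnm1E eq_sym (negPf neq_ji).
by rewrite expr0 fact0 invr1 scale1r.
Qed.

Lemma taylor_term_neq0 alpha p :
  taylor_term sigma alpha p != 0 -> alpha \in mnm_box (msize p).
Proof.
move=> nz_t; apply: mem_mnm_box => i; apply: (leq_trans (leq_mnm_mdeg _ _)).
apply/ltnW/mderivm_neq0; apply: contra_neq nz_t => d0.
by rewrite /taylor_term d0 mulr0.
Qed.

Hypothesis charK : [pchar K] =i pred0.

Lemma taylor_termX alpha mu :
  taylor_term sigma alpha 'X_[mu] =
  \prod_(i < m)
    (('X_i ^+ (mu i - alpha i) * (sigma 'X_i - 'X_i) ^+ alpha i)
       *+ 'C(mu i, alpha i)).
Proof.
rewrite /taylor_term mderivmX mpolyXE_id natr_prod -mul_mpolyC rmorph_prod /=.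
rewrite /taylor_coef -!big_split /=; apply: eq_bigr => i _.
rewrite mnmBE mul_mpolyC -scalerAl -scalerAr scalerA.
(* The falling factorial is ['C(mu i, alpha i) * (alpha i)!]; characteristic zero makes the
   factorial invertible, so it cancels. *)
rewrite -bin_ffact natrM mulrC mulfK; last first.
  by move/pcharf0P: charK => ->; rewrite -lt0n fact_gt0.
by rewrite scaler_nat mulrC.
Qed.

Lemma rmorph_taylorX (N : nat) mu :
  (forall i, mu i <= N)%N ->
  sigma 'X_[mu] = \sum_(alpha <- mnm_box N) taylor_term sigma alpha 'X_[mu].
Proof.
move=> le_muN; rewrite mpolyXE_id rmorph_prod.
pose F i k : {mpoly K[m]} :=
  ('X_i ^+ (mu i - k) * (sigma 'X_i - 'X_i) ^+ k) *+ 'C(mu i, k).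
rewrite (eq_bigr (fun i => \sum_(k < N.+1) F i k)) => [|i _]; last first.
  rewrite rmorphXn /= -[X in X ^+ _](addrNK 'X_i) [X in X ^+ _]addrC.
  by rewrite (exprDn_widen (mulrC _ _) (le_muN i)).
(* Choosing one binomial term per variable amounts to choosing a point of the box. *)
rewrite (bigA_distr_bigA (fun i (k : 'I_N.+1) => F i k)) -mpolyXE_id.
rewrite big_map big_enum /=; apply: eq_bigr => f _.
by rewrite taylor_termX; apply: eq_bigr => i _; rewrite mnmE.
Qed.

Lemma rmorph_taylor p :
  sigma p = \sum_(alpha <- mnm_box (msize p)) taylor_term sigma alpha p.
Proof.
(* Only the arguments of [sigma] and [taylor_term] are expanded; the box keeps the bound [msize p],
   which exceeds every exponent in the support of [p]. *)
rewrite {3}[p]mpolyE {1}[p]mpolyE linear_sum.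
under [RHS]eq_bigr do rewrite taylor_term_sumZ.
rewrite exchange_big /= big_seq [RHS]big_seq; apply: eq_bigr => mu p_mu.
rewrite linearZ -scaler_sumr -rmorph_taylorX // => i.
exact/(leq_trans (leq_mnm_mdeg _ _))/ltnW/msize_mdeg_lt.
Qed.

End Endomorphism.

End Taylor.

Theorem theorem7p5 (K : fieldType) (charK : [pchar K] =i pred0) (m : nat)
    (sigma : {lrmorphism {mpoly K[m]} -> {mpoly K[m]}})
    (sigma_bij : bijective sigma) (p : {mpoly K[m]}) :
  has_finsum xpredT (fun alpha : 'X_{1..m} => taylor_term sigma alpha p)
    (sigma p) /\
  exists rest : {mpoly K[m]},
    has_finsum (fun alpha : 'X_{1..m} => (2 <= mdeg alpha)%N)
      (fun alpha => taylor_term sigma alpha p) rest /\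
    sigma p = p + \sum_(i < m) (sigma 'X_i - 'X_i) * mderiv i p + rest.
Proof.
pose box := mnm_box m (msize p); pose T alpha := taylor_term sigma alpha p.
pose hi (alpha : 'X_{1..m}) := (2 <= mdeg alpha)%N.
have finT (P : pred 'X_{1..m}) : has_finsum P T (\sum_(a <- box | P a) T a).
  exists box; split=> [|alpha _|//]; first exact: mnm_box_uniq.
  exact: taylor_term_neq0.
split; first by rewrite (rmorph_taylor sigma charK p); apply: finT.
exists (\sum_(a <- box | hi a) T a); split; first exact: finT.
rewrite (rmorph_taylor sigma charK p) (bigID hi) /= addrC; congr (_ + _).
(* The part of degree at most 1 is now computed over a second list covering its support: the zero
   multi-index, giving [p], and the unit ones, giving the first-order terms. *)
apply: (has_finsum_unique (finT (predC hi))).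
exists (0%MM :: [seq U_(i)%MM | i <- enum 'I_m]); split.
- rewrite /= map_inj_uniq ?enum_uniq ?andbT; last first.
    move=> i j /mnmP/(_ i); rewrite !mnm1E eqxx.
    by case: eqP => // ->.
  by apply/mapP => -[i _ /esym/eqP]; rewrite mnm1_eq0.
- move=> alpha; rewrite /= /hi -ltnNge ltnS leq_eqVlt ltnS leqn0 inE => + _.
  case/orP=> [/mdeg1P[i /eqP ->]|]; last by rewrite mdeg_eq0 => ->.
  by rewrite map_f ?orbT // mem_enum.
- rewrite big_cons /= /hi mdeg0 /= /T taylor_term0; congr (_ + _).
  rewrite big_map big_enum_cond /=.
  by apply: eq_big => i; rewrite ?mdeg1 // taylor_termU.
Qed.
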